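(* Define $f:[1,\infty)\to\mathbb{R}$ by \[f(x)=\begin{cases}\dfrac12-\dfrac12\sqrt{\dfrac{x-1}{x+3}}, & \text{if } x\in\big[1,\tfrac{3\sqrt3}{2}-\tfrac32\big),\\[2mm] \dfrac{2\sqrt3-3}{x}, & \text{if } x\ge \tfrac{3\sqrt3}{2}-\tfrac32.\end{cases}\] Let $\xi$ be a centered non-zero real-valued random variable with $\mathbb{E}\xi^4<\infty$. Then \[\mathbb{P}(\xi\ge 0)\ \ge\ \mathbb{P}(\xi>0)\ \ge\ f(c_{4,2}^4),\] and the same lower bound holds for $\mathbb{P}(\xi<0)$ and $\mathbb{P}(\xi\le 0)$. Moreover, the estimates are already sharp for $\mathbb{P}(\xi\ge0)$ and $\mathbb{P}(\xi\le0)$: for every $x\ge 1$, the infimum of $\mathbb{P}(\xi\ge 0)$ over all centered non-zero real-valued random variables $\xi$ with $\mathbb{E}\xi^4<\infty$ and $c_{4,2}^4=x$ equals $f(x)$, and likewise for $\mathbb{P}(\xi\le 0)$.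
   Context: A real-valued random variable $\xi$ is centered if $\mathbb{E}|\xi|<\infty$ and $\mathbb{E}\xi=0$; non-zero means that $\xi$ is not almost surely equal to $0$. For a random variable $\xi$ and $q\in[1,\infty)$, $c_q=(\mathbb{E}|\xi|^q)^{1/q}$, and $c_{4,2}=c_4/c_2$; thus $c_{4,2}^4=\mathbb{E}\xi^4/(\mathbb{E}\xi^2)^2\ge 1$. The infimum in the sharpness statement is over random variables on arbitrary probability spaces. *)

(* Defs.v *)
From HB Require Import structures.
From mathcomp Require Import all_boot all_order all_algebra.
From mathcomp Require Import all_classical all_reals all_analysis.

Set Implicit Arguments.
Unset Strict Implicit.
Unset Printing Implicit Defensive.

Import Order.TTheory GRing.Theory Num.Theory.
Import numFieldNormedType.Exports.

Local Open Scope classical_set_scope.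
Local Open Scope ring_scope.

(* Only the values at x >= 1 are meaningful. *)
Definition f {R : realType} (x : R) : R :=
  if x < 3 * Num.sqrt 3 / 2 - 3 / 2
  then 1 / 2 - 1 / 2 * Num.sqrt ((x - 1) / (x + 3))
  else (2 * Num.sqrt 3 - 3) / x.

Section RandomVariable.
Context {d : measure_display} {T : measurableType d} {R : realType}.
Variables (P : probability T R) (X : {RV P >-> R}).

(* 'E_P[X] is defined for every X, so 'E_P[X] = 0 does not imply E|X| < +oo. *)
Definition centered : Prop :=
  ('E_P[fun w => `|X w|%R] < +oo)%E /\ 'E_P[X]%E = 0%E.

Definition nonzero_rv : Prop := ~ {ae P, forall w, X w = 0}.

Definition finite_fourth_moment : Prop := ('E_P[fun w => (X w ^+ 4)%R] < +oo)%E.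

Definition admissible : Prop :=
  [/\ centered, nonzero_rv & finite_fourth_moment].

(* c_q = (E|X|^q)^(1/q), as a real number; [fine] loses nothing for q = 2, 4
   when the fourth moment is finite. *)
Definition c (q : R) : R := fine ('N[P]_(q%:E)[EFin \o X])%E.

Definition c42 : R := c 4 / c 2.

End RandomVariable.

Definition probs_nonneg (R : realType) (x : R) : set (\bar R) :=
  [set p | exists (d : measure_display) (T : measurableType d)
             (P : probability T R) (X : {RV P >-> R}),
      [/\ admissible X, c42 X ^+ 4 = x & p = P [set w | 0 <= X w]]].

Definition probs_nonpos (R : realType) (x : R) : set (\bar R) :=
  [set p | exists (d : measure_display) (T : measurableType d)
             (P : probability T R) (X : {RV P >-> R}),
      [/\ admissible X, c42 X ^+ 4 = x & p = P [set w | X w <= 0]]].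

(* Main.v *)
Require Import Defs.
From HB Require Import structures.
From mathcomp Require Import all_boot all_order all_algebra.
From mathcomp Require Import all_classical all_reals all_analysis.
From mathcomp Require Import measurable_realfun ring lra.
Import Order.TTheory GRing.Theory Num.Theory.
Import numFieldNormedType.Exports.
Local Open Scope classical_set_scope.
Local Open Scope ring_scope.

(** Write [a] for the second moment of [X], [m] for the fourth, and
    [x = m / a ^+ 2], which is [c42 X ^+ 4].

    The lower bound is linear programming duality.  If a quartic without cubic
    term [c0 + c1 t + c2 t^2 + c4 t^4] lies below [A * 1_(t > 0)] on the whole
    line, integrating it at [t = b * X] bounds [A * P (X > 0)] from below by
    [c0 + c2 b^2 a + c4 b^4 m], since the linear term has mean zero
    ([quartic_moment_le]).  The good quartics touch the step function at the
    atoms of an extremal law.  For [s > 1], [tangent_quartic s] has a double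
    zero at [-1] and a maximum, of value [(s + 1)^3 (s - 1)], at [s]; it lies
    below the step function as soon as its value at [0],
    [-(1 + 2 s - 2 s^2)], is nonpositive, that is for
    [s <= (1 + sqrt 3) / 2] ([tangent_quartic_le]).

    For small [x] the extremal law is the centered law on [{-1, s}]: it has
    [x = s - 1 + 1 / s], gives mass [1 / (s + 1) = f x] to [s], and choosing
    [b] so that [b * X] has its second moment gives the bound
    ([two_point_bound]).  At [x = 1] one has [s = 1] and the quartic is useless,
    as [A = 0] there; the bound is then a limit of those for [s > 1].
    Beyond the threshold, [s] stays equal to [(1 + sqrt 3) / 2], where the
    quartic vanishes at [0] as well, so an atom at [0] becomes free; optimizing
    over the scale [b] gives [(2 sqrt 3 - 3) / x] ([f_le_of_moment_bounds]).

    For sharpness, the two-point law already has [P (X >= 0) = f x] below the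
    threshold.  Above it, the atom at [0] would count in [P (X >= 0)], so it is
    moved to [-e]: a mixture of the centered laws on [{-1, s}] and [{-e, s}]
    can be tuned to have exactly the prescribed [x] ([mixture_parameter]), and
    integrating the critical quartic against it shows that its mass at [s]
    exceeds [f x] by at most [e] ([three_point_near_optimal]).

    All statements about the negative side follow by passing to [- X]. *)

(** * The tangent quartics and the function [f] *)

(** The factor [t^2 - 2 t] makes the cubic term vanish on expansion; the constant
    [1 + 2 s - 2 s^2] then makes the derivative vanish at [s]. *)
Definition tangent_quartic {R : realType} (s t : R) : R :=
  - ((t + 1) ^+ 2 * (t ^+ 2 - 2 * t + (1 + 2 * s - 2 * s ^+ 2))).

(** On the positive side the difference is [(t - s)^2] times a
    nonnegative quadratic, which expresses the tangency at [s]; on the other side both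
    factors of the quartic are nonnegative. *)
Lemma tangent_quartic_le {R : realType} (s t : R) :
  1 <= s -> 0 <= 1 + 2 * s - 2 * s ^+ 2 ->
  tangent_quartic s t <= (s + 1) ^+ 3 * (s - 1) * (0 < t)%R%:R.
Proof.
move=> s1 k0; rewrite /tangent_quartic; case: ltP => [t0|t0].
  rewrite mulr1 -subr_ge0.
  have -> : (s + 1) ^+ 3 * (s - 1)
      - - ((t + 1) ^+ 2 * (t ^+ 2 - 2 * t + (1 + 2 * s - 2 * s ^+ 2))) =
      (t - s) ^+ 2 * ((t + s) ^+ 2 + 2 * (s - 1)) by ring.
  by rewrite mulr_ge0 ?sqr_ge0// addr_ge0 ?sqr_ge0// mulr_ge0// subr_ge0.
rewrite mulr0 oppr_le0 mulr_ge0 ?sqr_ge0//; nra.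
Qed.

(** The positive root of [1 + 2 s - 2 s^2], where the quartic reaches [0] at
    [0].  Beyond the threshold the nonzero atoms of the extremal law are [-1] and
    this value of [s], up to scale, and the threshold itself is
    [s - 1 + 1 / s]. *)
Definition critical_ratio {R : realType} : R := (1 + Num.sqrt 3) / 2.

Lemma sqrt3_sq {R : realType} : Num.sqrt 3 ^+ 2 = 3 :> R.
Proof. by rewrite sqr_sqrtr. Qed.

Lemma sqrt3_bounds {R : realType} : 17 / 10 < (Num.sqrt 3 : R) < 18 / 10.
Proof.
have := @sqrt3_sq R; have : 0 <= Num.sqrt 3 :> R by exact: sqrtr_ge0.
move: (Num.sqrt 3) => r r0 r2; apply/andP; split; nra.
Qed.

Lemma critical_ratio_sq {R : realType} :
  critical_ratio ^+ 2 = critical_ratio + 1 / 2 :> R.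
Proof.
rewrite /critical_ratio; have := @sqrt3_sq R.
move: (Num.sqrt 3) => r r2.
have -> : ((1 + r) / 2) ^+ 2 = (1 + 2 * r + r ^+ 2) / 4 by lra.
by rewrite r2; lra.
Qed.

Lemma critical_ratio_bounds {R : realType} :
  13 / 10 < (critical_ratio : R) < 14 / 10.
Proof.
by rewrite /critical_ratio; have /andP[? ?] := @sqrt3_bounds R;
  apply/andP; split; lra.
Qed.

Lemma sqrt3E {R : realType} : Num.sqrt 3 = 2 * critical_ratio - 1 :> R.
Proof. by rewrite /critical_ratio; field. Qed.

Lemma critical_quartic_max {R : realType} :
  (critical_ratio + 1) ^+ 3 * (critical_ratio - 1)
  = 3 * critical_ratio + 3 / 4 :> R.
Proof.
have := @critical_ratio_sq R; move: critical_ratio => q qq.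
have -> : (q + 1) ^+ 3 * (q - 1) =
    q ^+ 2 * q ^+ 2 + 2 * q * q ^+ 2 - 2 * q - 1 by ring.
by rewrite qq; nra.
Qed.

(** The two-point law on [{-1, s}] has [x = s - 1 + 1 / s]; solving for [s] with
    [D = sqrt ((x - 1) / (x + 3))] gives [s = (1 + D) / (1 - D)].  As
    [s - 1 + 1 / s] increases on [s >= 1], staying below the threshold keeps [s]
    below [critical_ratio]. *)
Lemma f_two_point_regime {R : realType} (x : R) :
  1 <= x -> x < 3 * Num.sqrt 3 / 2 - 3 / 2 ->
  exists s, [/\ 1 <= s, 0 <= 1 + 2 * s - 2 * s ^+ 2,
                x * s = s ^+ 2 - s + 1 & f x = (s + 1)^-1].
Proof.
move=> x1 xc; rewrite /f xc.
have x3 : 0 < x + 3 by lra.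
set D := Num.sqrt _.
have D0 : 0 <= D by exact: sqrtr_ge0.
have D2 : D ^+ 2 * (x + 3) = x - 1.
  rewrite sqr_sqrtr ?divfK ?gt_eqF// divr_ge0//; lra.
have D1 : D < 1.
  rewrite ltNge; apply/negP => D1.
  have : 1 <= D ^+ 2 by rewrite exprn_ege1.
  by rewrite -(ler_pM2r x3) D2; lra.
have D1' : 0 < 1 - D by lra.
have D1n : 1 - D != 0 by rewrite gt_eqF.
exists ((1 + D) / (1 - D)); set s := (1 + D) / (1 - D).
have sD : s * (1 - D) = 1 + D by rewrite /s divfK.
have s1 : 1 <= s by rewrite /s ler_pdivlMr//; lra.
have xs : x * s = s ^+ 2 - s + 1.
  apply: (mulIf (x := (1 - D) ^+ 2)); first by rewrite expf_neq0.
  have -> : x * s * (1 - D) ^+ 2 = x * (s * (1 - D)) * (1 - D) by ring.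
  have -> : (s ^+ 2 - s + 1) * (1 - D) ^+ 2 =
    (s * (1 - D)) ^+ 2 - s * (1 - D) * (1 - D) + (1 - D) ^+ 2 by ring.
  by rewrite sD; nra.
split=> //; last first.
  apply: (mulIf (x := s + 1)); first by rewrite gt_eqF//; lra.
  rewrite mulVf; last by rewrite gt_eqF//; lra.
  by nra.
(* For s beyond critical_ratio, monotonicity of s - 1 + 1 / s contradicts xc. *)
rewrite leNgt; apply/negP => k0.
have := @critical_ratio_sq R; have := @critical_ratio_bounds R.
move: xc; rewrite sqrt3E; move: critical_ratio => q xc /andP[q1 q2] qq.
have sq : q < s by nra.
nra.
Qed.

(** The scale [b = sqrt (s / a)] gives [b * X] the second moment [s] of the
    extremal two-point law, for which the quartic inequality is an equality. *)
Lemma two_point_bound {R : realType} (s a m p : R) :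
  1 < s -> 0 <= 1 + 2 * s - 2 * s ^+ 2 -> 0 < a ->
  m * s <= a ^+ 2 * (s ^+ 2 - s + 1) ->
  (forall b : R, 0 < b -> (2 + 2 * s ^+ 2 - 2 * s) * (b ^+ 2 * a)
     - (1 + 2 * s - 2 * s ^+ 2) - b ^+ 4 * m <= (s + 1) ^+ 3 * (s - 1) * p) ->
  (s + 1)^-1 <= p.
Proof.
move=> s1 k0 a0 ms /(_ (Num.sqrt (s / a))).
rewrite sqrtr_gt0 divr_gt0//; last by lra.
move=> /(_ isT) H.
have b2 : Num.sqrt (s / a) ^+ 2 = s / a by rewrite sqr_sqrtr ?divr_ge0//; lra.
rewrite (exprM _ 2 2) b2 divfK ?gt_eqF// in H.
have H4 : (s / a) ^+ 2 * m <= s * (s ^+ 2 - s + 1).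
  rewrite expr_div_n mulrAC ler_pdivrMr ?exprn_gt0//.
  by nra.
have C0 : 0 < (s + 1) ^+ 2 * (s - 1) by rewrite mulr_gt0 ?exprn_gt0//; lra.
have s10 : 0 < s + 1 by lra.
rewrite -[_^-1]mul1r ler_pdivrMr// -(ler_pM2l C0) mulr1.
apply: (@le_trans _ _ ((s + 1) ^+ 3 * (s - 1) * p)); last first.
  by rewrite le_eqVlt; apply/orP; left; apply/eqP; ring.
apply: le_trans H; rewrite -subr_ge0.
move: H4; set A := _ * m => H4; rewrite -subr_ge0 in H4.
apply: le_trans H4 _; rewrite le_eqVlt; apply/orP; left; apply/eqP; ring.
Qed.

(** The purely numerical half of the lower bound: the family of inequalities
    indexed by the shape [s] and the scale [b] of the quartic, optimized over
    both. *)
Lemma f_le_of_moment_bounds {R : realType} (a m p : R) :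
  0 < a -> a ^+ 2 <= m -> 0 <= p ->
  (forall s b : R, 0 < b -> 1 < s -> 0 <= 1 + 2 * s - 2 * s ^+ 2 ->
     (2 + 2 * s ^+ 2 - 2 * s) * (b ^+ 2 * a)
     - (1 + 2 * s - 2 * s ^+ 2) - b ^+ 4 * m <= (s + 1) ^+ 3 * (s - 1) * p) ->
  f (m / a ^+ 2) <= p.
Proof.
move=> a0 am p0 H.
have a20 : 0 < a ^+ 2 by rewrite exprn_gt0.
have m0 : 0 < m by exact: lt_le_trans am.
set x := m / a ^+ 2; have mE : m = x * a ^+ 2 by rewrite /x divfK// gt_eqF.
have x1 : 1 <= x by rewrite /x ler_pdivlMr// mul1r.
clearbody x; have x0 : 0 < x by lra.
have [xc|xc] := ltP x (3 * Num.sqrt 3 / 2 - 3 / 2).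
  have [s [s1 k0 xs ->]] := f_two_point_regime _ x1 xc.
  have [s1'|s1'] := ltP 1 s.
    apply: (@two_point_bound _ s a m) => //.
      by rewrite mE mulrAC xs mulrC.
    by move=> b b0; exact: H.
  have se : s = 1 by apply/eqP; rewrite eq_le s1 s1'.
  rewrite {}se in xs *.
  rewrite leNgt; apply/negP => p2.
  have {}p2 : p < 1 / 2 by move: p2; rewrite -[1 + 1]/(2 : R); lra.
  (* The bound for s2 would read p * (s2 + 1) >= 1, false for a slight excess of
     s2 over 1. *)
  pose s2 := 1 + (1 / 2 - p) / 2.
  have s21 : 1 < s2 by rewrite /s2; lra.
  have k2 : 0 <= 1 + 2 * s2 - 2 * s2 ^+ 2 by rewrite /s2; nra.
  have : (s2 + 1)^-1 <= p.
    apply: (@two_point_bound _ s2 a m) => //; last by move=> b b0; exact: H.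
    have x1E : x = 1 by lra.
    by rewrite mE x1E mul1r ler_pM2l//; nra.
  rewrite -[_^-1]mul1r ler_pdivrMr; last by lra.
  by rewrite /s2; nra.
rewrite /f ltNge xc/= ler_pdivrMr; last by lra.
have /andP[q1 q2] := @critical_ratio_bounds R.
have qq := @critical_ratio_sq R.
have k0 : 1 + 2 * critical_ratio - 2 * critical_ratio ^+ 2 = 0 :> R.
  by rewrite qq; lra.
(* The scale maximizes 3 b^2 a - b^4 m over b. *)
have {H} := H critical_ratio (Num.sqrt (3 / (2 * x * a))).
have xa : 0 < 2 * x * a by rewrite !mulr_gt0.
rewrite sqrtr_gt0 divr_gt0// => /(_ isT).
rewrite k0 (exprM _ 2 2) sqr_sqrtr; last by rewrite divr_ge0// ltW.
have -> : 3 / (2 * x * a) * a = 3 / (2 * x).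
  by field; rewrite !gt_eqF.
have -> : (3 / (2 * x * a)) ^+ 2 * m = 9 / (4 * x).
  by rewrite mE; field; rewrite !gt_eqF.
move=> H; have {H} : 9 / (4 * x) <=
    (critical_ratio + 1) ^+ 3 * (critical_ratio - 1) * p.
  apply: le_trans (H _ _); [|by lra|by []].
  have -> : 2 + 2 * critical_ratio ^+ 2 - 2 * critical_ratio = 3 :> R.
    by rewrite qq; lra.
  by rewrite le_eqVlt; apply/orP; left; apply/eqP; field; rewrite gt_eqF.
rewrite critical_quartic_max sqrt3E ler_pdivrMr; last by lra.
move: critical_ratio q1 q2 qq {k0} => q q1 q2 qq.
by nra.
Qed.

(** * Moments and the lower bound *)

Lemma c_pow {d : measure_display} {T : measurableType d} {R : realType}
    (P : probability T R) (X : {RV P >-> R}) (n : nat) :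
  (0 < n)%N -> ~~ odd n ->
  c X n%:R ^+ n = fine 'E_P[fun w => (X w ^+ n)%R]%E.
Proof.
move=> n0 en; rewrite /c -powR_mulrn; last first.
  by rewrite fine_ge0// Lnorm_ge0.
rewrite -fine_poweR poweR_Lnorm; last by rewrite pnatr_eq0 -lt0n.
rewrite unlock; congr fine; apply: eq_integral => w _ /=.
by rewrite powR_mulrn// -normrX ger0_norm// exprn_even_ge0.
Qed.

Lemma c42_pow4 {d : measure_display} {T : measurableType d} {R : realType}
    (P : probability T R) (X : {RV P >-> R}) :
  c42 X ^+ 4 = fine 'E_P[fun w => (X w ^+ 4)%R]%E
               / fine 'E_P[fun w => (X w ^+ 2)%R]%E ^+ 2.
Proof. by rewrite /c42 expr_div_n (c_pow _ X 4)// (exprM _ 2 2) (c_pow _ X 2). Qed.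

Lemma measurable_gt0_set {d : measure_display} {T : measurableType d}
    {R : realType} (X : {mfun T >-> R}) : measurable [set w | 0 < X w].
Proof.
have -> : [set w | 0 < X w] = X @^-1` `]0, +oo[.
  by apply/seteqP; split=> w /=; rewrite in_itv/= andbT.
exact: measurable_funPTI.
Qed.

Lemma measurable_ge0_set {d : measure_display} {T : measurableType d}
    {R : realType} (X : {mfun T >-> R}) : measurable [set w | 0 <= X w].
Proof.
have -> : [set w | 0 <= X w] = X @^-1` `[0, +oo[.
  by apply/seteqP; split=> w /=; rewrite in_itv/= andbT.
exact: measurable_funPTI.
Qed.

Section moments.
Context {d : measure_display} {T : measurableType d} {R : realType}.
Variables (P : probability T R) (X : {RV P >-> R}).

Lemma measurable_power n : measurable_fun setT (fun w => X w ^+ n).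
Proof. by apply: measurable_funX. Qed.

Hypotheses (cX : centered X) (X4 : finite_fourth_moment X).

Lemma centered_Lfun1 : (X : T -> R) \in Lfun P 1.
Proof.
apply/Lfun1_integrable/integrableP; split; first exact/measurable_EFinP.
by case: cX; rewrite unlock.
Qed.

Lemma fourth_power_Lfun1 : (fun w => X w ^+ 4) \in Lfun P 1.
Proof.
apply/Lfun1_integrable/integrableP; split.
  exact/measurable_EFinP/measurable_power.
move: X4; rewrite /finite_fourth_moment unlock; congr (_ < _)%E.
by apply: eq_integral => w _ /=; rewrite ger0_norm// exprn_even_ge0.
Qed.

Lemma square_Lfun1 : (fun w => X w ^+ 2) \in Lfun P 1.
Proof.
apply/Lfun1_integrable.
have : P.-integrable setT (EFin \o (cst 1 \+ (fun w => X w ^+ 4))).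
  apply/Lfun1_integrable/rpredD; [exact: Lfun_cst|exact: fourth_power_Lfun1].
apply: le_integrable => //; first exact/measurable_EFinP/measurable_power.
move=> w _ /=; rewrite lee_fin !ger0_norm ?sqr_ge0 ?addr_ge0 ?exprn_even_ge0//.
have := sqr_ge0 (X w ^+ 2 - 1); nra.
Qed.

Local Notation a := (fine 'E_P[fun w => (X w ^+ 2)%R]%E).
Local Notation m := (fine 'E_P[fun w => (X w ^+ 4)%R]%E).

(** Weak duality: [X] is centered, so [c1] drops out after integration. *)
Lemma quartic_moment_le (A c0 c1 c2 c4 : R) :
  (forall t : R, c0 + c1 * t + c2 * t ^+ 2 + c4 * t ^+ 4 <= A * (0 < t)%R%:R) ->
  c0 + c2 * a + c4 * m <= A * fine (P [set w | 0 < X w]).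
Proof.
move=> H; set S := [set w | _].
have mS : measurable S by exact: measurable_gt0_set.
have L1 := centered_Lfun1; have L2 := square_Lfun1.
have L4 := fourth_power_Lfun1.
have LS : (\1_S : T -> R) \in Lfun P 1.
  by apply/Lfun1_integrable/integrable_indic.
have LK r : (cst r : T -> R) \in Lfun P 1 by exact: Lfun_cst.
have LZ r (g : T -> R) : g \in Lfun P 1 -> r \o* g \in Lfun P 1.
  exact: Lfun_scale.
have : (0 <= 'E_P[((A \o* \1_S \+ (- c2) \o* (fun w => X w ^+ 2)%R)
    \+ ((- c4) \o* (fun w => X w ^+ 4)%R \+ ((- c1) \o* X \+ cst (- c0))))%R])%E.
  apply: expectation_ge0 => w /=.
  have -> : \1_S w = (0 < X w)%R%:R :> R.
    by rewrite indicE; congr (nat_of_bool _)%:R; apply/idP/idP; rewrite inE.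
  have := H (X w); lra.
rewrite !expectationD ?rpredD ?LZ//.
rewrite !expectationZl// expectation_cst expectation_indic//.
case: (cX) => _ ->; rewrite mule0 add0e.
rewrite -(fineK (expectation_fin_num L2)) -(fineK (expectation_fin_num L4)).
rewrite -[P S]fineK ?fin_num_measure// -!EFinM -!EFinD lee_fin; lra.
Qed.

Lemma second_moment_gt0 : nonzero_rv X -> 0 < a.
Proof.
move=> nz; rewrite lt0r fine_ge0 ?andbT; last first.
  by apply: expectation_ge0 => w; exact: sqr_ge0.
apply/eqP => a0; apply: nz.
have E0 : 'E_P[fun w => (X w ^+ 2)%R]%E = 0%E.
  by rewrite -(fineK (expectation_fin_num square_Lfun1)) a0.
have mX2 : measurable_fun setT (fun w => (X w ^+ 2)%:E).
  exact/measurable_EFinP/measurable_power.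
have [H _] := ae_eq_integral_abs P measurableT mX2.
have /H : (\int[P]_w `|(X w ^+ 2)%:E| = 0)%E.
  rewrite -E0 unlock; apply: eq_integral => w _ /=.
  by rewrite ger0_norm// sqr_ge0.
apply: filterS => w /(_ I) /= [] /eqP.
by rewrite expf_eq0 => /eqP.
Qed.

(** Integrate [0 <= (X^2 - a)^2]; this is the case of a multiplier [A = 0]. *)
Lemma second_moment_sq_le : a ^+ 2 <= m.
Proof.
have := @quartic_moment_le 0 (- a ^+ 2) 0 (2 * a) (- 1).
rewrite mul0r => H; suff : - a ^+ 2 + 2 * a * a + -1 * m <= 0 by nra.
apply: H => t; have := sqr_ge0 (t ^+ 2 - a).
by move: (fine _) => z; nra.
Qed.

Lemma f_le_prob_gt0 : nonzero_rv X ->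
  ((f (c42 X ^+ 4))%:E <= P [set w | (0 < X w)%R])%E.
Proof.
move=> nz; rewrite -[P _]fineK ?fin_num_measure//; last first.
  exact: measurable_gt0_set.
rewrite lee_fin c42_pow4; apply: f_le_of_moment_bounds.
- exact: second_moment_gt0.
- exact: second_moment_sq_le.
- exact: fine_ge0.
move=> s b b0 s1 k0.
have /= := @quartic_moment_le ((s + 1) ^+ 3 * (s - 1))
  (- (1 + 2 * s - 2 * s ^+ 2))
  ((4 * s ^+ 2 - 4 * s) * b) ((2 + 2 * s ^+ 2 - 2 * s) * b ^+ 2) (- b ^+ 4).
move=> H; apply: le_trans (H _).
  by rewrite le_eqVlt; apply/orP; left; apply/eqP; ring.
move=> t; have -> : (0 < t) = (0 < b * t) by rewrite pmulr_rgt0.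
apply: le_trans (tangent_quartic_le _ (b * t) (ltW s1) k0).
by rewrite /tangent_quartic le_eqVlt; apply/orP; left; apply/eqP; ring.
Qed.

End moments.

(** * Change of sign *)

Section opposite.
Context {d : measure_display} {T : measurableType d} {R : realType}.
Variables (P : probability T R) (X : {RV P >-> R}).

Definition opp_rv : {RV P >-> R} := - (X : {mfun T >-> R}).

Lemma opp_rvE w : opp_rv w = - X w. Proof. by []. Qed.

Lemma c42_opp : c42 opp_rv = c42 X.
Proof. by rewrite /c42 /c -2!(oppe_Lnorm P (EFin \o X)). Qed.

Lemma centered_opp : centered X -> centered opp_rv.
Proof.
move=> cX; split.
  have -> : (fun w => `|opp_rv w|) = (fun w => `|X w|).
    by apply/funext => w; rewrite /= normrN.
  by case: cX.
have -> : (opp_rv : T -> R) = -1 \o* X.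
  by apply/funext => w /=; rewrite mulrN1.
by rewrite expectationZl ?(centered_Lfun1 _ _ cX)// cX.2 mule0.
Qed.

Lemma nonzero_opp : nonzero_rv X -> nonzero_rv opp_rv.
Proof.
move=> nz z; apply: nz; apply: filterS z => w /eqP.
by rewrite opp_rvE oppr_eq0 => /eqP.
Qed.

Lemma finite_fourth_moment_opp :
  finite_fourth_moment X -> finite_fourth_moment opp_rv.
Proof.
rewrite /finite_fourth_moment.
have -> // : (fun w => opp_rv w ^+ 4) = (fun w => X w ^+ 4).
by apply/funext => w /=; rewrite exprNn -signr_odd expr0 mul1r.
Qed.

End opposite.

Lemma probs_nonpos_nonneg {R : realType} (x : R) :
  probs_nonpos x = probs_nonneg x.
Proof.
apply/seteqP; split => y [d [T [P [X [[cX nX X4] xE ->]]]]].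
all: exists d, T, P, (opp_rv P X); split.
1,4: by split; [exact: centered_opp|exact: nonzero_opp|
  exact: finite_fourth_moment_opp].
1,3: by rewrite c42_opp.
all: by congr (P _); apply/seteqP; split => w /=; rewrite ?oppr_ge0 ?oppr_le0.
Qed.

(** * Extremal laws *)

(** Hides the structure behind an equality of set functions: unfolding it is
    expensive in later proofs. *)
Lemma probability_of_measure {d : measure_display} {T : measurableType d}
    {R : realType} (mu : {measure set T -> \bar R}) : mu setT = 1%E ->
  exists P : probability T R, P = mu :> (set T -> \bar R).
Proof.
case: mu => m cm mu1.
pose P : probability T R :=
  HB.pack m cm
    (Measure_isProbability.Build _ _ _ (Measure.Pack cm) mu1).
by exists P.
Qed.

Section three_points.
Context {R : realType}.
Variables (p u w : {nonneg R}) (x y z : R).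

Definition three_point_measure : {measure set R -> \bar R} :=
  measure_add (measure_add (mscale p \d_x) (mscale u \d_y)) (mscale w \d_z).

Lemma three_point_measureE (A : set R) : three_point_measure A =
  (p%:num * (x \in A)%:R + u%:num * (y \in A)%:R + w%:num * (z \in A)%:R)%:E.
Proof.
rewrite [LHS]measure_addE [X in (X + _)%E]measure_addE.
reflexivity.
Qed.

Lemma integral_three_point (h : R -> R) :
  measurable_fun setT h -> (forall t, 0 <= h t) ->
  (\int[three_point_measure]_t (h t)%:E)%E =
  (p%:num * h x + u%:num * h y + w%:num * h z)%:E.
Proof.
move=> mh h0; have mE : measurable_fun setT (EFin \o h) by exact/measurable_EFinP.
have h0E t : setT t -> (0 <= (h t)%:E)%E by rewrite lee_fin.
rewrite /three_point_measure !ge0_integral_measure_add// !ge0_integral_mscale//.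
by rewrite !integral_dirac// !diracT !mul1e -!EFinM -!EFinD.
Qed.

End three_points.

(** The identity of the line under the law [p d_s + u d_(-1) + w d_(-e)].
    Integrals against this law are computed for nonnegative functions; the mean
    is reached through [E (X + |X|) - E |X|]. *)
Lemma three_point_law {R : realType} (s e p u w : R) :
  0 < s -> 0 < e -> 0 < p -> 0 <= u -> 0 <= w -> p + u + w = 1 ->
  p * s = u + w * e ->
  probs_nonneg ((p * s ^+ 4 + u + w * e ^+ 4)
    / (p * s ^+ 2 + u + w * e ^+ 2) ^+ 2) p%:E.
Proof.
move=> s0 e0 p0 u0 w0 pT mean.
pose mu := three_point_measure (NngNum (ltW p0)) (NngNum u0) (NngNum w0)
  s (-1) (- e).
have muT : mu setT = 1%E.
  by rewrite /mu three_point_measureE/= !in_setT !mulr1 pT.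
have [P PE] := probability_of_measure mu muT.
have [X XE] : exists X : {RV P >-> R}, X = idfun :> (R -> R).
  pose X : {RV P >-> R} := HB.pack (idfun : R -> R)
    (isMeasurableFun.Build _ _ _ _ idfun (@measurable_id _ R setT)).
  by exists X.
have EE (h : R -> R) : measurable_fun setT h -> (forall t, 0 <= h t) ->
    'E_P[h]%E = (p * h s + u * h (-1) + w * h (- e))%:E.
  move=> mh h0; rewrite unlock (@eq_measure_integral _ _ _ _ mu).
    exact: (integral_three_point _ _ _ _ _ _ _ mh h0).
  by move=> A _ _; exact: (congr1 (@^~ A) PE).
have Emn n : ~~ odd n -> 'E_P[fun t => (X t ^+ n)%R]%E =
    (p * s ^+ n + u + w * e ^+ n)%:E.
  move=> en; rewrite XE EE; last 2 first.
  - exact: (measurable_funX n (@measurable_id _ R setT)).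
  - by move=> t; exact: exprn_even_ge0.
  have xN t : (- t) ^+ n = t ^+ n :> R.
    by rewrite exprNn -signr_odd (negbTE en) expr0 mul1r.
  by rewrite !xN expr1n mulr1.
have Eabs : 'E_P[fun t => `|X t|%R]%E = (p * s + u + w * e)%:E.
  rewrite XE EE => [||//]; last exact: (@normr_measurable _ setT).
  by rewrite !normrN normr1 mulr1 !gtr0_norm.
have a0 : 0 < p * s ^+ 2 + u + w * e ^+ 2.
  have ps : 0 < p * s ^+ 2 by rewrite mulr_gt0// exprn_gt0.
  by have we : 0 <= w * e ^+ 2 by [rewrite mulr_ge0// sqr_ge0]; lra.
have EX : 'E_P[X]%E = 0%E.
  have L1 : (X : R -> R) \in Lfun P 1.
    apply/Lfun1_integrable/integrableP; split; first exact/measurable_EFinP.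
    by move: Eabs; rewrite unlock => ->; rewrite ltry.
  have L1n : (fun t => `|X t|) \in Lfun P 1.
    apply/Lfun1_integrable/integrableP; split.
      by apply/measurable_EFinP/measurableT_comp.
    move: Eabs; rewrite unlock => E; under eq_integral do rewrite /= normr_id.
    by rewrite E ltry.
  have : 'E_P[X \+ (fun t => `|X t|%R)]%E = (p * s + u + w * e)%:E.
    rewrite XE EE/=.
    - by rewrite !normrN normr1 !gtr0_norm//; congr EFin; lra.
    - exact: (measurable_funD (@measurable_id _ R setT) (@normr_measurable R setT)).
    - by move=> t; have := ler_norm (- t); rewrite normrN; lra.
  rewrite expectationD//.
  rewrite Eabs -(fineK (expectation_fin_num L1)) -EFinD => -[] E0.
  by congr EFin; lra.
exists _, _, P, X; split.
- split.
  + by split=> //; rewrite Eabs ltry.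
  + move=> z; move: a0; rewrite -lte_fin -(Emn 2)// lt_neqAle => /andP[/eqP[]].
    rewrite unlock (@ae_eq_integral _ _ _ _ _ (cst 0%E)) ?integral0//.
      exact/measurable_EFinP/measurable_power.
    by apply: filterS z => t -> _; rewrite expr0n.
  + by rewrite /finite_fourth_moment (Emn 4)// ltry.
- by rewrite c42_pow4 (Emn 4)// (Emn 2).
- rewrite PE /mu three_point_measureE/= XE/=.
  have -> : s \in [set t | 0 <= t] by rewrite inE/= ltW.
  have /negbTE -> : (-1) \notin [set t : R | 0 <= t] by rewrite notin_setE/= ler0N1.
  have /negbTE -> : - e \notin [set t | 0 <= t].
    by rewrite notin_setE/= oppr_ge0; apply/negP; rewrite -ltNge.
  by rewrite !mulr0 !addr0 mulr1.
Qed.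

(** The degenerate three-point law with no mass at [-e]. *)
Lemma two_point_law {R : realType} (s x : R) :
  1 <= s -> x * s = s ^+ 2 - s + 1 -> probs_nonneg x (s + 1)^-1%:E.
Proof.
move=> s1 xs; have s0 : 0 < s by lra.
have s10 : 0 < s + 1 by lra.
have sn : s != 0 by rewrite gt_eqF.
have s1n : s + 1 != 0 by rewrite gt_eqF.
have := @three_point_law R s 1 (s + 1)^-1 (s / (s + 1)) 0 s0 ltr01.
rewrite invr_gt0 => /(_ s10 (divr_ge0 (ltW s0) (ltW s10)) (lexx 0)).
have -> : (s + 1)^-1 + s / (s + 1) + 0 = 1 by field.
have -> : (s + 1)^-1 * s = s / (s + 1) + 0 * 1 by field.
move=> /(_ erefl erefl).
have -> // : ((s + 1)^-1 * s ^+ 4 + s / (s + 1) + 0 * 1 ^+ 4)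
  / ((s + 1)^-1 * s ^+ 2 + s / (s + 1) + 0 * 1 ^+ 2) ^+ 2 = x.
have -> : (s + 1)^-1 * s ^+ 2 + s / (s + 1) + 0 * 1 ^+ 2 = s by field.
have -> : (s + 1)^-1 * s ^+ 4 + s / (s + 1) + 0 * 1 ^+ 4 = s * (x * s).
  by rewrite xs; field.
by field.
Qed.

(** With weight [th] on the centered law on [{-1, q}] and [1 - th] on the one on
    [{-e, q}], the two sides are [x] times the square of the second moment, and
    the fourth moment.  At [th = 1] the ratio is at most [x] because [x] is
    beyond the threshold, and at [th = 0] it is about [q / e], hence large; both
    sides are polynomial in [th], so they agree somewhere in between. *)
Lemma mixture_parameter {R : realType} (x e : R) (q := critical_ratio) :
  0 < e -> e * (x + 1) <= 1 -> q ^+ 2 - q + 1 <= x * q ->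
  exists2 th, 0 <= th <= 1 &
    x * (q * (th + (1 - th) * e)) ^+ 2 =
    q * (th * (q ^+ 2 - q + 1) + (1 - th) * e * (q ^+ 2 - q * e + e ^+ 2)).
Proof.
move=> e0 ex qx; have /andP[q1 q2] := @critical_ratio_bounds R.
rewrite -/q in q1 q2; clearbody q.
pose A2 : {poly R} := q *: ('X + (1 - 'X) * e%:P).
pose A4 : {poly R} := q *: ('X * (q ^+ 2 - q + 1)%:P
  + (1 - 'X) * (e * (q ^+ 2 - q * e + e ^+ 2))%:P).
have hE t : (x *: A2 ^+ 2 - A4).[t] = x * (q * (t + (1 - t) * e)) ^+ 2 -
    q * (t * (q ^+ 2 - q + 1) + (1 - t) * e * (q ^+ 2 - q * e + e ^+ 2)).
  by rewrite /A2 /A4 !(hornerE, horner_exp).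
have [|t t01 /rootP] := @poly_ivt R (x *: A2 ^+ 2 - A4) 0 1 ler01.
  rewrite !hE; apply/andP; split.
    have -> : x * (q * (0 + (1 - 0) * e)) ^+ 2 - q * (0 * (q ^+ 2 - q + 1)
      + (1 - 0) * e * (q ^+ 2 - q * e + e ^+ 2))
      = - (q * e * (q * (q - e * (x + 1)) + e ^+ 2)) by ring.
    rewrite oppr_le0 mulr_ge0 ?mulr_ge0//; [lra|lra|].
    by rewrite addr_ge0 ?sqr_ge0// mulr_ge0//; lra.
  have -> : x * (q * (1 + (1 - 1) * e)) ^+ 2 - q * (1 * (q ^+ 2 - q + 1)
      + (1 - 1) * e * (q ^+ 2 - q * e + e ^+ 2))
      = q * (x * q - (q ^+ 2 - q + 1)) by ring.
  by rewrite mulr_ge0//; lra.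
by rewrite hE => /eqP; rewrite subr_eq0 => /eqP tE; exists t.
Qed.

(** The critical quartic [2 t + 3 t^2 - t^4] is tight at [q] and at [-1] and
    loses only [e (2 - 3 e + e^3)] at [-e].  Integrating it gives
    [A p <= 3 a - x a^2 + 2 e] with [A = 3 q + 3/4], and
    [3 a - x a^2 <= 9 / (4 x) = A (2 sqrt 3 - 3) / x] for every [a]. *)
Lemma three_point_near_optimal {R : realType} (x e : R) :
  3 * Num.sqrt 3 / 2 - 3 / 2 <= x -> 0 < e -> e <= 1 -> e * (x + 1) <= 1 ->
  exists2 p, probs_nonneg x p%:E & p <= f x + e.
Proof.
move=> xc e0 e1 ex; rewrite /f ltNge xc/=.
have /andP[q1 q2] := @critical_ratio_bounds R.
have qq := @critical_ratio_sq R.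
rewrite sqrt3E in xc *.
have qx : critical_ratio ^+ 2 - critical_ratio + 1 <= x * critical_ratio.
  by nra.
have [t /andP[t0 t1]] := mixture_parameter x e e0 ex qx.
have Cmax := @critical_quartic_max R.
move: critical_ratio q1 q2 qq xc {qx} Cmax => q q1 q2 qq xc Cmax tE.
have q0 : 0 < q by lra.
have q10 : 0 < q + 1 by lra.
have qe0 : 0 < q + e by lra.
have x0 : 0 < x by lra.
pose p := t / (q + 1) + (1 - t) * e / (q + e).
pose u := t * q / (q + 1).
pose w := (1 - t) * q / (q + e).
have u0 : 0 <= u by rewrite divr_ge0 ?mulr_ge0// ltW.
have w0 : 0 <= w by rewrite divr_ge0 ?mulr_ge0//; lra.
have pT : p + u + w = 1 by rewrite /p /u /w; field; rewrite !gt_eqF.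
have mean : p * q = u + w * e by rewrite /p /u /w; field; rewrite !gt_eqF.
have E2 : p * q ^+ 2 + u + w * e ^+ 2 = q * (t + (1 - t) * e).
  by rewrite /p /u /w; field; rewrite !gt_eqF.
have E4 : p * q ^+ 4 + u + w * e ^+ 4 = x * (q * (t + (1 - t) * e)) ^+ 2.
  by rewrite tE /p /u /w; field; rewrite !gt_eqF.
set a := q * (t + (1 - t) * e) in E2 E4.
have a0 : 0 < a by rewrite /a mulr_gt0//; nra.
clearbody a p u w.
have p0 : 0 < p.
  have : 0 < p * q; last by rewrite pmulr_lgt0.
  (* If both terms of the mean vanished, so would p, hence a. *)
  have : 0 <= w * e by rewrite mulr_ge0// ltW.
  rewrite mean le_eqVlt => /orP[/eqP we|we]; last by lra.
  rewrite -we addr0 lt_neqAle u0 andbT; apply/eqP => uE.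
  move: pT mean a0; rewrite -E2 -uE -we; nra.
exists p.
  have := @three_point_law R q e p u w q0 e0 p0 u0 w0 pT mean.
  rewrite E2 E4; have -> // : x * a ^+ 2 / a ^+ 2 = x.
  by rewrite mulfK// expf_neq0// gt_eqF.
have Cp : (q + 1) ^+ 3 * (q - 1) * p = 3 * a - x * a ^+ 2
    + w * e * (2 - 3 * e + e ^+ 3).
  have uE : u = p * q - w * e by lra.
  have CE : (q + 1) ^+ 3 * (q - 1) = 3 * q ^+ 2 - q ^+ 4 + 2 * q.
    by rewrite Cmax (exprM _ 2 2) qq; nra.
  by rewrite CE -E4 -{1}E2 uE; ring.
have we2 : w * e * (2 - 3 * e + e ^+ 3) <= 2 * e.
  have e2 : e ^+ 2 <= 1 by rewrite expr_le1// ltW.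
  have w1 : w <= 1 by lra.
  have e3 : 2 - 3 * e + e ^+ 3 <= 2 by rewrite exprS; nra.
  have we1 : w * e <= e by rewrite ler_piMl// ltW.
  apply: (@le_trans _ _ (w * e * 2)); last by lra.
  by rewrite ler_wpM2l// mulr_ge0// ltW.
have a2 : 3 * a - x * a ^+ 2 <= 9 / (4 * x).
  rewrite ler_pdivlMr; last by lra.
  by have := sqr_ge0 (2 * x * a - 3); nra.
have {Cp we2 a2} : (3 * q + 3 / 4) * p <= 9 / (4 * x) + 2 * e.
  by rewrite -Cmax Cp; lra.
have -> : 9 / (4 * x) = (3 * q + 3 / 4) * ((2 * (2 * q - 1) - 3) / x).
  have CE : (3 * q + 3 / 4) * (2 * (2 * q - 1) - 3) = 9 / 4 by nra.
  by rewrite mulrA CE; field; rewrite gt_eqF.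
move=> H; have C0 : 0 < 3 * q + 3 / 4 by lra.
by rewrite -(ler_pM2l C0) mulrDr; apply: le_trans H _; rewrite lerD2l ler_pM2r//; lra.
Qed.

(** * Sharpness *)

Lemma ereal_inf_probs_nonneg {R : realType} (x : R) :
  1 <= x -> ereal_inf (probs_nonneg x) = (f x)%:E.
Proof.
move=> x1; apply/le_anti/andP; split; last first.
  apply: le_ereal_inf_tmp => _ [d [T [P [X [[cX nX X4] <- ->]]]]].
  apply: le_trans (f_le_prob_gt0 P X cX X4 nX) _.
  apply: le_measure; rewrite ?inE; [exact: measurable_gt0_set|
    exact: measurable_ge0_set|by move=> w /= /ltW].
have [xc|xc] := ltP x (3 * Num.sqrt 3 / 2 - 3 / 2).
  have [s [s1 _ xs ->]] := f_two_point_regime _ x1 xc.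
  by apply: ereal_inf_lbound; exact: two_point_law.
apply/lee_addgt0Pr => e e0.
have x10 : 0 < (x + 1)^-1 by rewrite invr_gt0; lra.
pose e' := Num.min (Num.min 1 e) (x + 1)^-1.
have e'0 : 0 < e' by rewrite !lt_min ltr01 e0 x10.
have [p px pe] : exists2 p, probs_nonneg x p%:E & p <= f x + e'.
  apply: three_point_near_optimal => //.
    by rewrite !ge_min lexx.
  rewrite -[leRHS](@mulVf _ (x + 1)); last by rewrite gt_eqF//; lra.
  by rewrite ler_pM2r; [rewrite ge_min lexx orbT|lra].
apply: le_trans (ereal_inf_lbound px) _.
by rewrite -EFinD lee_fin (le_trans pe)// lerD2l !ge_min lexx !orbT.
Qed.

Theorem proposition2p3 (R : realType) :
  (forall (d : measure_display) (T : measurableType d) (P : probability T R)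
          (X : {RV P >-> R}),
     centered X -> nonzero_rv X -> finite_fourth_moment X ->
     [/\ (P [set w | (0 < X w)%R] <= P [set w | (0 <= X w)%R])%E,
         ((f (c42 X ^+ 4))%:E <= P [set w | (0 < X w)%R])%E,
         ((f (c42 X ^+ 4))%:E <= P [set w | (X w < 0)%R])%E
       & ((f (c42 X ^+ 4))%:E <= P [set w | (X w <= 0)%R])%E])
  /\
  (forall x : R, 1 <= x ->
     ereal_inf (probs_nonneg x) = (f x)%:E /\
     ereal_inf (probs_nonpos x) = (f x)%:E).
Proof.
split=> [d T P X cX nX X4|x x1]; last first.
  by rewrite probs_nonpos_nonneg ereal_inf_probs_nonneg.
have gt_le (Y : {RV P >-> R}) :
    (P [set w | (0 < Y w)%R] <= P [set w | (0 <= Y w)%R])%E.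
  by apply: le_measure; rewrite ?inE; [exact: measurable_gt0_set|
    exact: measurable_ge0_set|move=> w /= /ltW].
have lt0E : [set w | X w < 0] = [set w | 0 < opp_rv P X w].
  by apply/seteqP; split=> w /=; rewrite oppr_gt0.
have le0E : [set w | X w <= 0] = [set w | 0 <= opp_rv P X w].
  by apply/seteqP; split=> w /=; rewrite oppr_ge0.
have lower_opp : ((f (c42 X ^+ 4))%:E <= P [set w | (X w < 0)%R])%E.
  rewrite lt0E -(c42_opp P X); apply: f_le_prob_gt0; first exact: centered_opp.
    exact: finite_fourth_moment_opp.
  exact: nonzero_opp.
split=> //; first exact: f_le_prob_gt0.
by apply: le_trans lower_opp _; rewrite lt0E le0E.
Qed.
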